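(* Let $k,n,m\in\mathbb{N}$ and let $\mathbf{H}$ be a random oracle drawn uniformly from $\mathsf{Fcs}(k,n,m)$. Let $\mathcal{A}$ be an order-consistent quantum adversary that makes $p$ quantum queries to the random oracle $\mathbf{H}$ and $q$ classical queries to $\textsc{Ev}$. Then \[\mathsf{Adv}^{\mathsf{prf}}_{\mathsf{FFX}}(\mathcal{A})\le\sqrt{\frac{8(p+q)pq}{2^{k+n}}}.\]
   Context: $\mathsf{Fcs}(k,n,m)$ is the set of all functions $\mathbf{H}:\{0,1\}^k\times\{0,1\}^n\to\{0,1\}^m$. We write $\mathbf{H}_K(x)=\mathbf{H}(K,x)$. Quantum access to $\mathbf{H}$ is the unitary $|K,x,y\rangle\mapsto|K,x,y\oplus\mathbf{H}_K(x)\rangle$. The construction FFX with key $K_1\|K_2\in\{0,1\}^k\times\{0,1\}^n$ is $\mathsf{FFX}[\mathbf{H}](K_1\|K_2,x)=\mathbf{H}_{K_1}(x\oplus K_2)$. The PRF game with bit $b$ samples $\mathbf{H}$ uniformly, a uniform key $K_1\|K_2$, and an independent uniform function $F:\{0,1\}^n\to\{0,1\}^m$. The adversary has quantum access to $\mathbf{H}$ and classical access to $\textsc{Ev}$: - if $b=1$, $\textsc{Ev}$ returns $\mathsf{FFX}[\mathbf{H}](K_1\|K_2,\cdot)$; - if $b=0$, $\textsc{Ev}$ returns $F(\cdot)$. The advantage is $\Pr[\mathcal{A}\text{ outputs }1\mid b=1]-\Pr[\mathcal{A}\text{ outputs }1\mid b=0]$. An adversary with several oracles is order consistent if the order in which it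 alternates between queries to the different oracles is fixed a priori, before execution. *)

(* Defs.v *)
From HB Require Import structures.
From mathcomp Require Import all_boot all_order all_algebra.
From mathcomp Require Import reals.
From mathcomp Require Import complex.
Set Implicit Arguments. Unset Strict Implicit. Unset Printing Implicit Defensive.
Import Order.TTheory GRing.Theory Num.Theory.
Local Open Scope ring_scope.

Definition bits (n : nat) := {ffun 'I_n -> bool}.
Definition bxor (n : nat) (a b : bits n) : bits n := [ffun i => xorb (a i) (b i)].

Definition Fcs (k n m : nat) := {ffun bits k * bits n -> bits m}.

Definition FFX (k n m : nat) (H : Fcs k n m) (K1 : bits k) (K2 : bits n)
  (x : bits n) : bits m := H (K1, bxor x K2).

(** Computational basis of the adversary's Hilbert space:
    (H-query register |K,x,y>) * (Ev-query register |x',y'>) * workspace W. *)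
Definition basis (k n m : nat) (W : finType) :=
  ((bits k * bits n * bits m) * (bits n * bits m) * W)%type.

Section Quantum.
Variable R : realType.
Local Notation C := (R[i]).

Definition sqmod (z : C) : R := complex.Re z ^+ 2 + complex.Im z ^+ 2.
Definition cconj (z : C) : C := Complex (complex.Re z) (- complex.Im z).

Variable T : finType.
Definition state := T -> C.
Definition operator := T -> T -> C.
Definition apply_op (U : operator) (psi : state) : state :=
  fun z => \sum_(x : T) U z x * psi x.
Definition unitary (U : operator) : Prop :=
  forall x y : T, \sum_(z : T) cconj (U z x) * U z y = (x == y)%:R.
Definition sqnorm (psi : state) : R := \sum_(t : T) sqmod (psi t).
End Quantum.

Section Game.
Variables (R : realType) (k n m : nat).

(** An order-consistent adversary: the interleaving [sched] of queries is fixed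
    in advance (true = quantum query to H, false = classical query to Ev).
    It starts in the unit vector [psi0], applies [U 0], then for the i-th
    entry of [sched] performs the query and then [U i.+1]; finally it
    measures in the computational basis and outputs 1 iff the outcome
    lies in [acc]. *)
Record adversary := Adversary {
  W : finType;
  psi0 : state R (basis k n m W);
  sched : seq bool;
  U : nat -> operator R (basis k n m W);
  acc : pred (basis k n m W)
}.
Arguments W : clear implicits.
Arguments psi0 : clear implicits.
Arguments sched : clear implicits.
Arguments U : clear implicits.
Arguments acc : clear implicits.

Definition valid_adversary (A : adversary) : Prop :=
  sqnorm (psi0 A) = 1 /\ forall i, unitary (U A i).

Definition nquantum (A : adversary) : nat := count id (sched A).
Definition nclassical (A : adversary) : nat := count negb (sched A).

Variable A : adversary.
Local Notation T := (basis k n m (W A)).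

(** quantum access to H : |K,x,y> |-> |K,x,y xor H_K(x)> *)
Definition OH (H : Fcs k n m) (psi : state R T) : state R T :=
  fun t => let: (((K, x, y), e), w) := t in
           psi (((K, x, bxor y (H (K, x))), e), w).

(** Ev oracle f applied to the Ev register |x,y> |-> |x, y xor f x> *)
Definition OEv (f : bits n -> bits m) (psi : state R T) : state R T :=
  fun t => let: ((h, (x, y)), w) := t in psi ((h, (x, bxor y (f x))), w).

(** projector onto outcome x of a computational-basis measurement of the
    input part of the Ev register: a classical query measures the input *)
Definition proj_in (x : bits n) (psi : state R T) : state R T :=
  fun t => if t.1.2.1 == x then psi t else 0.

(** Probability (summed over the outcomes of the classical-query
    measurements, with unnormalised branch states) that the adversary
    outputs 1, starting with state psi before applying U i, with
    remaining schedule s. *)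
Fixpoint run (H : Fcs k n m) (f : bits n -> bits m)
   (s : seq bool) (i : nat) (psi : state R T) : R :=
  let phi := apply_op (U A i) psi in
  match s with
  | [::] => \sum_(t | acc A t) sqmod (phi t)
  | true :: s' => run H f s' i.+1 (OH H phi)
  | false :: s' => \sum_(x : bits n) run H f s' i.+1 (OEv f (proj_in x phi))
  end.

Definition out_prob (H : Fcs k n m) (f : bits n -> bits m) : R :=
  run H f (sched A) 0 (psi0 A).

Definition avg (X : finType) (g : X -> R) : R := (#|X|%:R)^-1 * \sum_(x : X) g x.

Definition prob_real : R :=
  avg (fun H : Fcs k n m => avg (fun K1 : bits k => avg (fun K2 : bits n =>
       out_prob H (FFX H K1 K2)))).

Definition prob_ideal : R :=
  avg (fun H : Fcs k n m => avg (fun F : {ffun bits n -> bits m} =>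
       out_prob H F)).

Definition adv_prf_FFX : R := prob_real - prob_ideal.
End Game.

(* Main.v *)
Require Import Defs.
From HB Require Import structures.
From mathcomp Require Import all_boot all_order all_algebra.
From mathcomp Require Import reals complex.
From mathcomp Require Import boolp ring lra.
Set Implicit Arguments. Unset Strict Implicit. Unset Printing Implicit Defensive.
Import Order.TTheory GRing.Theory Num.Theory.
Local Open Scope ring_scope.

(** Hybrid argument along the fixed query schedule, with N = 2^(k+n). In each
    hybrid a prefix of the queries is answered ideally, by H and F; let L be
    the list of Ev inputs measured so far. The remaining queries are answered
    as in the real game by M, which is H reprogrammed to F x at
    (K1, x xor K2) for every x in L. The key is thus independent of the state
    reached after the prefix, and moving one query into the prefix costs, for
    every t > 0, at most

    - t + |L| / (N t) for a query to H, since H and M differ on |L| points that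
      are uniform given the state;

    - t + d / (N t) for a query to Ev after d queries to H. If x is not in L,
      the value F x is fresh, so the two hybrids differ by resampling H at the
      uniform point z = (K1, x xor K2) after the prefix. Each amplitude is a
      polynomial of degree at most d in H, in the sense that d + 1 distinct
      operators 1 - E_z kill it, where E_z averages over the value H z. For
      such functions sum_z |(1 - E_z) f|^2 <= d |f|^2.

    Optimising t gives 2 (p sqrt (q / N) + q sqrt (p / N)), which is at most
    the stated bound. *)

(** * Averages and resampling *)

Section Average.
Variable R : realType.
Implicit Types X Y : finType.

Lemma eq_avg X (f g : X -> R) : f =1 g -> avg f = avg g.
Proof. by move=> fg; rewrite /avg (eq_bigr g) // => x _; rewrite fg. Qed.

Lemma avgD X (f g : X -> R) : avg (fun x => f x + g x) = avg f + avg g.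
Proof. by rewrite /avg big_split mulrDr. Qed.

Lemma avgZ X c (f : X -> R) : avg (fun x => c * f x) = c * avg f.
Proof. by rewrite /avg -mulr_sumr mulrCA. Qed.

Lemma avgB X (f g : X -> R) : avg (fun x => f x - g x) = avg f - avg g.
Proof. by rewrite /avg sumrB mulrBr. Qed.

Lemma avg_sum X (I : Type) (r : seq I) (P : pred I) (f : I -> X -> R) :
  avg (fun x => \sum_(i <- r | P i) f i x) = \sum_(i <- r | P i) avg (f i).
Proof. by rewrite /avg exchange_big mulr_sumr. Qed.

Lemma avg_exchange X Y (f : X -> Y -> R) :
  avg (fun x => avg (f x)) = avg (fun y => avg (f^~ y)).
Proof.
by rewrite /avg -!mulr_sumr [in RHS]exchange_big /= mulrCA.
Qed.

Lemma ler_avg X (f g : X -> R) : (forall x, f x <= g x) -> avg f <= avg g.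
Proof. by move=> fg; rewrite ler_wpM2l ?invr_ge0 ?ler0n // ler_sum. Qed.

Lemma avg_ge0 X (f : X -> R) : (forall x, 0 <= f x) -> 0 <= avg f.
Proof. by move=> f0; rewrite mulr_ge0 ?invr_ge0 ?ler0n // sumr_ge0. Qed.

Lemma avg_cst X (c : R) : (0 < #|X|)%N -> avg (fun _ : X => c) = c.
Proof.
move=> X0; rewrite /avg sumr_const -[c *+ _]mulr_natl mulKf //.
by rewrite pnatr_eq0 -lt0n.
Qed.

Lemma avg_pair X Y (f : X * Y -> R) :
  avg (fun x => avg (fun y => f (x, y))) = avg f.
Proof.
rewrite /avg -mulr_sumr mulrA card_prod natrM invfM pair_bigA.
by congr (_ * _); apply: eq_bigr => -[].
Qed.

Lemma avg_bij X Y (h : X -> Y) (f : Y -> R) :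
  bijective h -> avg (fun x => f (h x)) = avg f.
Proof.
move=> hb; rewrite /avg (bij_eq_card hb); congr (_ * _).
by rewrite [RHS](reindex h) //; apply: onW_bij.
Qed.

End Average.

Section Update.
Variables Z Y : finType.
Implicit Types (H : {ffun Z -> Y}) (z w : Z) (y : Y).

Definition upd H z y : {ffun Z -> Y} := [ffun w => if w == z then y else H w].

Lemma updE H z y w : upd H z y w = if w == z then y else H w.
Proof. by rewrite ffunE. Qed.

Lemma upd_id H z : upd H z (H z) = H.
Proof. by apply/ffunP => w; rewrite updE; case: eqP => // ->. Qed.

Lemma updK H z y y' : upd (upd H z y) z y' = upd H z y'.
Proof. by apply/ffunP => w; rewrite !updE; case: eqP. Qed.

Lemma updC H z w y y' : z != w ->
  upd (upd H z y) w y' = upd (upd H w y') z y.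
Proof.
move=> zw; apply/ffunP => v; rewrite !updE.
by case: (v =P w) => // ->; rewrite eq_sym (negbTE zw).
Qed.

Variable R : realType.

(** The map sending [(H, y)] to [(upd H z y, H z)] is an involution, so a uniform function and its
    resampled copy are exchangeable. *)
Lemma avg_swap z (g : {ffun Z -> Y} -> {ffun Z -> Y} -> R) :
  avg (fun H => avg (fun y => g H (upd H z y))) =
  avg (fun H => avg (fun y => g (upd H z y) H)).
Proof.
pose s (a : {ffun Z -> Y} * Y) := (upd a.1 z a.2, a.1 z).
have sK : involutive s.
  by case=> H y; rewrite /s /= updK upd_id updE eqxx.
rewrite (avg_pair (fun a => g a.1 (upd a.1 z a.2))).
rewrite (avg_pair (fun a => g (upd a.1 z a.2) a.1)).
rewrite -(avg_bij _ (inv_bij sK)); apply: eq_avg => -[H y] /=.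
by rewrite updK upd_id.
Qed.

Hypothesis Y0 : (0 < #|Y|)%N.

Lemma avg_resample z (g : {ffun Z -> Y} -> R) :
  avg g = avg (fun H => avg (fun y => g (upd H z y))).
Proof.
rewrite (avg_swap z (fun _ => g)); apply: eq_avg => H.
by rewrite avg_cst.
Qed.

End Update.

(** * Complex amplitudes: polarisation, variance and convexity *)

Section Sqmod.
Variable R : realType.
Local Notation C := (R[i]).
Implicit Types a b : C.

Lemma sqmod_ge0 a : 0 <= sqmod a.
Proof. by rewrite addr_ge0 ?sqr_ge0. Qed.

Lemma sqmod0 : sqmod (0 : C) = 0.
Proof. by rewrite /sqmod expr0n addr0. Qed.

Lemma sqmod_conj a : (sqmod a)%:C%C = cconj a * a.
Proof.
by case: a => x y; apply/eqP; rewrite eq_complex /sqmod /cconj /=; apply/andP;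
   split; apply/eqP; ring.
Qed.

(** The middle bracket is twice the real inner product of [a] and [b], spelt out by polarisation so
    that it matches [polar] below. *)
Lemma sqmod_lincomb (r s : R) a b :
  sqmod (r%:C%C * a + s%:C%C * b) =
  r ^+ 2 * sqmod a + r * s * (sqmod (a + b) - sqmod a - sqmod b)
  + s ^+ 2 * sqmod b.
Proof. by case: a b => [x y] [x' y']; rewrite /sqmod /=; ring. Qed.

(** Parallelogram law: the right side exceeds the left by a quarter of [|a + b|^2]. *)
Lemma sqmod_half a b : sqmod (2^-1%:C%C * (a - b)) <= (sqmod a + sqmod b) / 2.
Proof.
case: a b => [x y] [x' y']; rewrite /sqmod /=.
rewrite -subr_ge0 (_ : _ - _ = ((x + x') ^+ 2 + (y + y') ^+ 2) / 4).
  by rewrite divr_ge0 ?addr_ge0 ?sqr_ge0.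
by field.
Qed.

Lemma ReD a b : complex.Re (a + b) = complex.Re a + complex.Re b.
Proof. by case: a b => [x y] [x' y']. Qed.
Lemma ImD a b : complex.Im (a + b) = complex.Im a + complex.Im b.
Proof. by case: a b => [x y] [x' y']. Qed.

Lemma Re_sum (I : finType) (f : I -> C) :
  complex.Re (\sum_i f i) = \sum_i complex.Re (f i).
Proof. exact: (big_morph _ ReD). Qed.
Lemma Im_sum (I : finType) (f : I -> C) :
  complex.Im (\sum_i f i) = \sum_i complex.Im (f i).
Proof. exact: (big_morph _ ImD). Qed.

Definition cavg (Y : finType) (f : Y -> C) : C :=
  ((#|Y|%:R : R)^-1)%:C%C * \sum_y f y.

Lemma Re_cavg (Y : finType) (f : Y -> C) :
  complex.Re (cavg f) = avg (fun y => complex.Re (f y)).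
Proof. by rewrite /cavg /avg -Re_sum; case: (\sum_y f y) => x y /=; ring. Qed.
Lemma Im_cavg (Y : finType) (f : Y -> C) :
  complex.Im (cavg f) = avg (fun y => complex.Im (f y)).
Proof. by rewrite /cavg /avg -Im_sum; case: (\sum_y f y) => x y /=; ring. Qed.

Lemma avg_sqr (Y : finType) (f : Y -> R) : (0 < #|Y|)%N ->
  avg (fun y => f y ^+ 2) = avg f ^+ 2 + avg (fun y => (f y - avg f) ^+ 2).
Proof.
move=> Y0; set mu := avg f.
have E y : (f y - mu) ^+ 2 = f y ^+ 2 - 2 * mu * f y + mu ^+ 2 by ring.
by rewrite (eq_avg E) avgD avgB avgZ avg_cst // -/mu; ring.
Qed.

(** Variance decomposition, applied to the real and imaginary parts separately. *)
Lemma avg_sqmod (Y : finType) (f : Y -> C) : (0 < #|Y|)%N ->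
  avg (fun y => sqmod (f y)) =
  sqmod (cavg f) + avg (fun y => sqmod (f y - cavg f)).
Proof.
move=> Y0; rewrite avgD.
rewrite (avg_sqr (fun y => complex.Re (f y))) //.
rewrite (avg_sqr (fun y => complex.Im (f y))) //.
rewrite addrACA -avgD /sqmod Re_cavg Im_cavg; congr (_ + _).
apply: eq_avg => y; rewrite -Re_cavg -Im_cavg.
by case: (f y) (cavg f) => [? ?] [? ?].
Qed.

Lemma sqmod_cavg (Y : finType) (f : Y -> C) : (0 < #|Y|)%N ->
  sqmod (cavg f) <= avg (fun y => sqmod (f y)).
Proof.
by move=> Y0; rewrite avg_sqmod // lerDl avg_ge0 // => y; apply: sqmod_ge0.
Qed.

End Sqmod.

(** * Degree of functions of a random function *)

Section Degree.
Variables (R : realType) (Z Y : finType).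
Local Notation C := (R[i]).
Hypothesis Y0 : (0 < #|Y|)%N.
Implicit Types (H : {ffun Z -> Y}) (z w : Z) (f g : {ffun Z -> Y} -> C).

(** This is E_z, the conditional expectation given all values of [H] except the one at [z];
    [fluct z] is 1 - E_z. All these operators commute. *)
Definition smooth z f H : C := cavg (fun y => f (upd H z y)).
Definition fluct z f H : C := f H - smooth z f H.

Lemma cavg_exchange (X X' : finType) (h : X -> X' -> C) :
  cavg (fun x => cavg (h x)) = cavg (fun y => cavg (h^~ y)).
Proof. by rewrite /cavg -!mulr_sumr [in RHS]exchange_big /= mulrCA. Qed.

Lemma cavg_cst (c : C) : cavg (fun _ : Y => c) = c.
Proof.
rewrite /cavg sumr_const -[c *+ _]mulr_natl mulrA.
rewrite -(rmorph_nat (real_complex R)) -rmorphM mulVf ?rmorph1 ?mul1r //.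
by rewrite pnatr_eq0 -lt0n.
Qed.

Lemma cavgB (X : finType) (h h' : X -> C) :
  cavg (fun x => h x - h' x) = cavg h - cavg h'.
Proof. by rewrite /cavg sumrB mulrBr. Qed.

Lemma cavgZ (X : finType) c (h : X -> C) :
  cavg (fun x => c * h x) = c * cavg h.
Proof. by rewrite /cavg -mulr_sumr mulrCA. Qed.

Lemma cavg_sum (X I : finType) (h : I -> X -> C) :
  cavg (fun x => \sum_i h i x) = \sum_i cavg (h i).
Proof. by rewrite /cavg exchange_big mulr_sumr. Qed.

Lemma smooth_upd z f H y : smooth z f (upd H z y) = smooth z f H.
Proof. by congr (cavg _); apply: funext => y'; rewrite updK. Qed.

Lemma smoothC z w f : smooth z (smooth w f) = smooth w (smooth z f).
Proof.
have [->//|zw] := eqVneq z w; apply: funext => H.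
rewrite /smooth cavg_exchange; congr (cavg _); apply: funext => y.
by congr (cavg _); apply: funext => y'; rewrite updC.
Qed.

Lemma smoothB z f g :
  smooth z (fun H => f H - g H) = (fun H => smooth z f H - smooth z g H).
Proof. by apply: funext => H; apply: cavgB. Qed.

Lemma smooth_fluctC z w f : smooth z (fluct w f) = fluct w (smooth z f).
Proof. by rewrite /fluct smoothB smoothC. Qed.

Lemma fluctC z w f : fluct z (fluct w f) = fluct w (fluct z f).
Proof.
rewrite {1 3}/fluct; apply: funext => H.
by rewrite !smooth_fluctC /fluct smoothC; ring.
Qed.

Lemma smooth0 z : smooth z (fun _ => 0) = (fun _ => 0).
Proof. by apply: funext => H; apply: cavg_cst. Qed.

Lemma fluct0 z : fluct z (fun _ => 0) = (fun _ => 0).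
Proof. by apply: funext => H; rewrite /fluct smooth0 subr0. Qed.

Definition fluct_seq zs f := foldr fluct f zs.

Lemma fluct_seq_fluct zs z f :
  fluct_seq zs (fluct z f) = fluct z (fluct_seq zs f).
Proof. by elim: zs => //= w zs ->; apply: fluctC. Qed.

Lemma fluct_seq_smooth zs z f :
  fluct_seq zs (smooth z f) = smooth z (fluct_seq zs f).
Proof. by elim: zs => //= w zs ->; rewrite smooth_fluctC. Qed.

(** Confining the points to a list [D] allows induction over the coordinates; [deg] is the version
    over all points. *)
Definition deg_in (D : seq Z) (d : nat) f :=
  forall zs, uniq zs -> {subset zs <= D} -> size zs = d.+1 ->
  fluct_seq zs f = (fun _ => 0).

Definition weight f : R := avg (fun H => sqmod (f H)).

(** With the other values of [H] fixed, [smooth z f] is the mean of [f] and [fluct z f] the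
    deviation from it. *)
Lemma weight_pythagoras z f :
  weight f = weight (smooth z f) + weight (fluct z f).
Proof.
rewrite {1}/weight (avg_resample Y0 z).
rewrite [weight (fluct z f)](avg_resample Y0 z) -avgD.
apply: eq_avg => H; rewrite avg_sqmod //; congr (_ + _).
by apply: eq_avg => y; rewrite /fluct smooth_upd.
Qed.

Lemma weight0 : weight (fun _ => 0) = 0.
Proof. by rewrite /weight (eq_avg (fun=> @sqmod0 R)) /avg big1 ?mulr0. Qed.

(* Splitting f = smooth z f + fluct z f orthogonally, the second summand
   has one degree less in the remaining coordinates. *)
Lemma weight_fluct_in D d f : uniq D -> deg_in D d f ->
  \sum_(z <- D) weight (fluct z f) <= d%:R * weight f.
Proof.
have weight_ge0 g : 0 <= weight g by apply: avg_ge0 => H; apply: sqmod_ge0.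
elim: D d f => [|z D IH] d f /=; first by rewrite big_nil mulr_ge0 ?ler0n.
case/andP=> zD uD fd; rewrite big_cons.
under eq_bigr => w _ do
  rewrite (weight_pythagoras z) smooth_fluctC [in X in _ + X]fluctC.
rewrite big_split /= [weight f](weight_pythagoras z).
have sd : deg_in D d (smooth z f).
  move=> zs uzs szs nzs; rewrite fluct_seq_smooth fd ?smooth0 //.
  by move=> w /szs; rewrite inE orbC => ->.
have IHs := IH d _ uD sd.
case: d fd sd IHs => [|d] fd sd IHs.
  have f0 : fluct z f = (fun _ => 0).
    by apply: (fd [:: z]) => // w; rewrite !inE => /eqP->; rewrite eqxx.
  rewrite f0 [X in _ + (_ + X)]big1 => [|w _]; last by rewrite fluct0 weight0.
  by rewrite weight0 addr0 add0r addr0.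
have {}IH := IH d (fluct z f) uD.
have qd : deg_in D d (fluct z f).
  move=> zs uzs szs nzs; rewrite fluct_seq_fluct; apply: (fd (z :: zs)).
  - by rewrite /= uzs andbT; apply: contra zD => /szs.
  - by move=> w; rewrite !inE => /orP[->//|/szs->]; rewrite orbT.
  - by rewrite /= nzs.
(* The smooth part contributes [d.+1] times its weight; the fluctuating part contributes [d] times
   its weight, plus once more from the head [z]. *)
have := IH qd; rewrite -[d.+1]addn1 natrD; move: IHs.
rewrite -[d.+1]addn1 natrD.
move: (\sum_(_ <- _) _) (\sum_(_ <- _) _) => a b; lra.
Qed.

Definition deg d f :=
  forall zs, uniq zs -> size zs = d.+1 -> fluct_seq zs f = (fun _ => 0).

Lemma weight_fluct d f : deg d f ->
  \sum_z weight (fluct z f) <= d%:R * weight f.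
Proof.
move=> fd; have fD : deg_in (enum Z) d f by move=> zs uzs _; apply: fd.
by have := weight_fluct_in (enum_uniq _) fD; rewrite big_enum.
Qed.

Lemma deg_cst d (c : C) : deg d (fun _ => c).
Proof.
case=> // z zs _ _ /=; rewrite -fluct_seq_fluct.
have -> : fluct z (fun _ => c) = (fun _ => 0).
  by apply: funext => H; rewrite /fluct /smooth cavg_cst subrr.
by elim: zs => //= w zs ->; apply: fluct0.
Qed.

Lemma fluctM_indep z f g : (forall H y, g (upd H z y) = g H) ->
  fluct z (fun H => g H * f H) = (fun H => g H * fluct z f H).
Proof.
move=> gz; apply: funext => H; rewrite /fluct mulrBr; congr (_ - _).
by rewrite -cavgZ; congr (cavg _); apply: funext => y; rewrite gz.
Qed.

Lemma fluct_sum (I : finType) z (f : I -> {ffun Z -> Y} -> C) :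
  fluct z (fun H => \sum_i f i H) = (fun H => \sum_i fluct z (f i) H).
Proof.
by apply: funext => H; rewrite /fluct sumrB; congr (_ - _); apply: cavg_sum.
Qed.

Lemma deg_lincomb (I : finType) d (c : I -> C) (f : I -> {ffun Z -> Y} -> C) :
  (forall i, deg d (f i)) -> deg d (fun H => \sum_i c i * f i H).
Proof.
move=> fd zs uzs nzs.
have -> : fluct_seq zs (fun H => \sum_i c i * f i H) =
  (fun H => \sum_i c i * fluct_seq zs (f i) H).
  elim: zs {uzs nzs} => //= z zs ->; rewrite fluct_sum.
  by apply: funext => H; apply: eq_bigr => i _; rewrite fluctM_indep.
by apply: funext => H; rewrite big1 // => i _; rewrite (fd i zs) // mulr0.
Qed.

(** The factor [c (H w)] commutes with [fluct z] for every [z] other than [w]. Among d + 2 distinct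
    points, set aside [w] if it occurs and the first point otherwise: the remaining d + 1 points
    avoid [w] and already kill [f]. Commutation lets the point set aside act last. *)
Lemma degM_coord d w (c : Y -> C) f :
  deg d f -> deg d.+1 (fun H => c (H w) * f H).
Proof.
move=> fd.
have out zs : w \notin zs ->
    fluct_seq zs (fun H => c (H w) * f H) =
    (fun H => c (H w) * fluct_seq zs f H).
  elim: zs => //= z zs IH; rewrite inE negb_or => /andP[wz wzs].
  by rewrite (IH wzs) fluctM_indep // => H y; rewrite updE (negbTE wz).
move=> zs uzs nzs; case: (boolP (w \in zs)) => [wzs|/out ->]; last first.
  case: zs uzs nzs => //= z zs /andP[_ uzs] [nzs].
  by rewrite (fd zs) // fluct0; apply: funext => H; rewrite mulr0.
case/splitPr: wzs uzs nzs => s1 s2 u12.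
rewrite size_cat /= addnS => -[n12].
have /andP[w12 u12'] : (w \notin s1 ++ s2) && uniq (s1 ++ s2).
  by move: u12; rewrite uniq_catC /= uniq_catC !mem_cat orbC.
rewrite /fluct_seq foldr_cat /= -/(fluct_seq _ _) -/(fluct_seq _ _).
rewrite fluct_seq_fluct /fluct_seq -foldr_cat -/(fluct_seq _ _) out //.
rewrite (fd _ u12') ?size_cat //.
rewrite (_ : (fun H => _) = (fun _ => 0)) ?fluct0 //.
by apply: funext => H; rewrite mulr0.
Qed.

End Degree.

(** * Quadratic forms on states *)

Section QuadraticForm.
Variables (R : realType) (T : finType).
Local Notation C := (R[i]).
Local Notation state := (state R T).
Implicit Types (u v psi : state) (Q : state -> R).

Definition sadd u v : state := fun t => u t + v t.
(** For [Q] the squared norm this is twice the real inner product of [u] and [v]. *)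
Definition polar Q u v := Q (sadd u v) - Q u - Q v.
Definition quadratic Q := forall (r s : R) u v,
  Q (fun t => r%:C%C * u t + s%:C%C * v t) =
  r ^+ 2 * Q u + r * s * polar Q u v + s ^+ 2 * Q v.

Lemma quadratic_sqnorm : quadratic (@sqnorm R T).
Proof.
move=> r s u v; rewrite /sqnorm /polar /sqnorm -!sumrB !mulr_sumr -!big_split.
by apply: eq_bigr => t _; rewrite sqmod_lincomb.
Qed.

Lemma sqnorm_ge0 psi : 0 <= sqnorm psi.
Proof. by apply: sumr_ge0 => t _; apply: sqmod_ge0. Qed.

(** The form [|M psi|^2], with rows indexed by an arbitrary finite type so that several measurement
    branches can be stacked into one matrix. *)
Definition gram (J : finType) (M : J -> T -> C) psi : R :=
  \sum_j sqmod (\sum_t M j t * psi t).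

Lemma gram_ge0 (J : finType) (M : J -> T -> C) psi : 0 <= gram M psi.
Proof. by apply: sumr_ge0 => j _; apply: sqmod_ge0. Qed.

Lemma quadratic_gram (J : finType) (M : J -> T -> C) : quadratic (gram M).
Proof.
move=> r s u v; rewrite /polar /gram -!sumrB !mulr_sumr -!big_split.
apply: eq_bigr => j _ /=; rewrite /sadd.
have -> : \sum_t M j t * (u t + v t) = \sum_t M j t * u t + \sum_t M j t * v t.
  by rewrite -big_split; apply: eq_bigr => t _; rewrite mulrDr.
rewrite -sqmod_lincomb !mulr_sumr -big_split.
by congr sqmod; apply: eq_bigr => t _ /=; ring.
Qed.

(** Jensen's inequality, applied to the squared modulus of each row. *)
Lemma gram_cavg (J Y : finType) (M : J -> T -> C) (psi : Y -> state) :
  (0 < #|Y|)%N ->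
  gram M (fun t => cavg (fun y => psi y t)) <= avg (fun y => gram M (psi y)).
Proof.
move=> Y0; rewrite /gram avg_sum; apply: ler_sum => j _.
apply: le_trans (sqmod_cavg _ Y0); rewrite cavg_sum.
by rewrite [in leRHS](eq_bigr _ (fun t _ => cavgZ _ _)).
Qed.

(* Rescaling u and v inversely leaves the polar form unchanged. *)
Lemma polar_le Q tau u v : quadratic Q ->
  (forall psi, 0 <= Q psi) -> (forall psi, Q psi <= sqnorm psi) -> 0 < tau ->
  2 * polar Q u v <=
  tau * sqnorm u + sqnorm v / tau + polar (@sqnorm R T) u v.
Proof.
move=> qQ Q0 Q1 tau0; set r := Num.sqrt tau.
have r0 : 0 < r by rewrite sqrtr_gt0.
have rV : r * r^-1 = 1 by rewrite mulfV // gt_eqF.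
have r2 : r ^+ 2 = tau by rewrite sqr_sqrtr // ltW.
have r2V : r^-1 ^+ 2 = tau^-1 by rewrite exprVn r2.
(* For w = r u + v / r and w' = r u - v / r, the chain [Q w - Q w' <= Q w <= sqnorm w] is the claim,
   because its left end equals [2 * polar Q u v]. *)
have := Q1 (fun t => r%:C%C * u t + r^-1%:C%C * v t).
have := Q0 (fun t => r%:C%C * u t + (- r^-1)%:C%C * v t).
rewrite !qQ quadratic_sqnorm mulrN rV sqrrN r2 r2V.
lra.
Qed.

(** Write a = u + v and b = u - v. Then [Q a - Q b] is [2 * polar Q u v], and equality of the norms
    makes [u] and [v] orthogonal, so the last term of [polar_le] vanishes. *)
Lemma quadratic_diff_le Q tau a b : quadratic Q ->
  (forall psi, 0 <= Q psi) -> (forall psi, Q psi <= sqnorm psi) -> 0 < tau ->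
  sqnorm a = sqnorm b ->
  Q a - Q b <=
  tau * sqnorm a + sqnorm (fun t => 2^-1%:C%C * (a t - b t)) / tau.
Proof.
move=> qQ Q0 Q1 tau0 ab.
pose u : state := fun t => 2^-1%:C%C * (a t + b t).
set v : state := (fun t => 2^-1%:C%C * (a t - b t)).
have h2 : (2^-1%:C + 2^-1%:C)%C = 1 :> C.
  rewrite -rmorphD -[RHS](rmorph1 (real_complex R)).
  by congr (_%:C)%C; lra.
have ea : a = (fun t => 1%:C%C * u t + 1%:C%C * v t).
  by apply: funext => t; rewrite /u /v !mul1r -[LHS]mul1r -h2; ring.
have eb : b = (fun t => 1%:C%C * u t + (-1)%:C%C * v t).
  apply: funext => t; rewrite /u /v rmorphN !mul1r -[LHS]mul1r -h2; ring.
have := polar_le u v qQ Q0 Q1 tau0.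
have qN := quadratic_sqnorm.
have : sqnorm v >= 0 := sqnorm_ge0 _.
have Ea : Q a = Q u + polar Q u v + Q v by rewrite ea qQ; ring.
have Eb : Q b = Q u - polar Q u v + Q v by rewrite eb qQ; ring.
have Na : sqnorm a = sqnorm u + polar (@sqnorm R T) u v + sqnorm v.
  by rewrite ea qN; ring.
have Nb : sqnorm b = sqnorm u - polar (@sqnorm R T) u v + sqnorm v.
  by rewrite eb qN; ring.
rewrite Ea Eb => v0.
have P0 : polar (@sqnorm R T) u v = 0 by lra.
have : tau * sqnorm u <= tau * sqnorm a by rewrite ler_pM2l // Na P0; lra.
rewrite P0; lra.
Qed.

End QuadraticForm.

(** * Unitaries preserve the norm *)

Section Unitary.
Variables (R : realType) (T : finType).
Local Notation C := (R[i]).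

Lemma cconjM (a b : C) : cconj (a * b) = cconj a * cconj b.
Proof.
by case: a b => [x y] [x' y']; apply/eqP; rewrite eq_complex /cconj /=;
   apply/andP; split; apply/eqP; ring.
Qed.

Lemma cconjD (a b : C) : cconj (a + b) = cconj a + cconj b.
Proof.
by case: a b => [x y] [x' y']; apply/eqP; rewrite eq_complex /cconj /=;
   apply/andP; split; apply/eqP; ring.
Qed.

Lemma cconj_sum (f : T -> C) : cconj (\sum_i f i) = \sum_i cconj (f i).
Proof.
by apply: (big_morph _ cconjD); apply/eqP; rewrite eq_complex /= oppr0 !eqxx.
Qed.

Lemma sqnorm_unitary (V : operator R T) psi :
  unitary V -> sqnorm (apply_op V psi) = sqnorm psi.
Proof.
move=> uV; apply: (@complexI R); rewrite /sqnorm !rmorph_sum /=.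
under eq_bigr => z _ do rewrite sqmod_conj /apply_op cconj_sum big_distrlr /=.
rewrite exchange_big /=; apply: eq_bigr => x _; rewrite exchange_big /=.
rewrite (eq_bigr (fun y => cconj (psi x) * psi y * (x == y)%:R)) => [|y _].
  rewrite (bigD1 x) //= eqxx mulr1 big1 ?addr0 ?sqmod_conj // => y yx.
  by rewrite eq_sym (negbTE yx) mulr0.
by rewrite -uV mulr_sumr; apply: eq_bigr => z _; rewrite cconjM; ring.
Qed.

End Unitary.

(** * The acceptance probability as a quadratic form *)

Lemma bxorK n (b : bits n) : involutive ((@bxor n)^~ b).
Proof.
by move=> a; apply/ffunP => i; rewrite !ffunE; case: (a i) (b i) => [] [].
Qed.

Lemma bxorKl n (a : bits n) : involutive (bxor a).
Proof.
by move=> b; apply/ffunP => i; rewrite !ffunE; case: (a i) (b i) => [] [].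
Qed.

Lemma card_bits n : #|{: bits n}| = (2 ^ n)%N.
Proof. by rewrite card_ffun card_bool card_ord. Qed.

Lemma card_bits_gt0 n : (0 < #|{: bits n}|)%N.
Proof. by rewrite card_bits expn_gt0. Qed.

Section Run.
Variables (R : realType) (k n m : nat) (A : adversary R k n m).
Local Notation T := (basis k n m (W A)).
Local Notation C := (R[i]).
Hypothesis U_unitary : forall i, unitary (U (a := A) i).
Implicit Types (H M : Fcs k n m) (f : bits n -> bits m) (psi : state R T).

(** Oracle queries only permute the computational basis; xoring twice cancels, so each permutation
    is its own inverse. *)
Definition permH H (t : T) : T :=
  let: (((K, x, y), e), w) := t in (((K, x, bxor y (H (K, x))), e), w).
Definition permEv f (t : T) : T :=
  let: ((h, (x, y)), w) := t in ((h, (x, bxor y (f x))), w).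

Lemma permHK H : involutive (permH H).
Proof. by case=> [[[[K x] y] e] w] /=; rewrite bxorK. Qed.

Lemma permEvK f : involutive (permEv f).
Proof. by case=> [[h [x y]] w] /=; rewrite bxorK. Qed.

Lemma OHE H psi : OH H psi = psi \o permH H.
Proof. by apply: funext => -[[[[K x] y] e] w]. Qed.

Lemma OEvE f psi : OEv f psi = psi \o permEv f.
Proof. by apply: funext => -[[h [x y]] w]. Qed.

Lemma sqnorm_perm (s : T -> T) psi : involutive s ->
  sqnorm (psi \o s) = sqnorm psi.
Proof.
move=> sK; rewrite /sqnorm [RHS](reindex s) //.
exact/onW_bij/inv_bij.
Qed.

Lemma sqnorm_OH H psi : sqnorm (OH H psi) = sqnorm psi.
Proof. by rewrite OHE sqnorm_perm //; apply: permHK. Qed.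

Lemma sqnorm_OEv f psi : sqnorm (OEv f psi) = sqnorm psi.
Proof. by rewrite OEvE sqnorm_perm //; apply: permEvK. Qed.

Lemma sqnorm_proj_in psi : \sum_x sqnorm (proj_in x psi) = sqnorm psi.
Proof.
rewrite /sqnorm exchange_big /=; apply: eq_bigr => t _.
rewrite (bigD1 t.1.2.1) //= big1 ?addr0 /proj_in ?eqxx // => x xt.
by rewrite eq_sym (negbTE xt) sqmod0.
Qed.

Lemma run_le_sqnorm H f s i psi : run H f s i psi <= sqnorm psi.
Proof.
elim: s i psi => [|[] s IH] i psi /=.
- rewrite -(sqnorm_unitary psi (U_unitary i)) /sqnorm.
  rewrite [leRHS](bigID (acc (a := A))) /=.
  by rewrite lerDl sumr_ge0 // => t _; apply: sqmod_ge0.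
- by apply: le_trans (IH _ _) _; rewrite sqnorm_OH sqnorm_unitary.
- rewrite -(sqnorm_unitary psi (U_unitary i)) -sqnorm_proj_in.
  by apply: ler_sum => x _; apply: le_trans (IH _ _) _; rewrite sqnorm_OEv.
Qed.

(** This property passes through every step of [run], and it yields nonnegativity, the quadratic
    identity and Jensen's inequality at once. *)
Definition is_gram (Q : state R T -> R) :=
  exists (J : finType) (M : J -> T -> C), forall psi, Q psi = gram M psi.

Lemma is_gram_perm (s : T -> T) Q : involutive s -> is_gram Q ->
  is_gram (fun psi => Q (psi \o s)).
Proof.
move=> sK [J [M QE]]; exists J, (fun j t => M j (s t)) => psi; rewrite QE.
apply: eq_bigr => j _; congr sqmod; rewrite [RHS](reindex s) /=; last first.
  exact/onW_bij/inv_bij.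
by apply: eq_bigr => t _; rewrite sK.
Qed.

Lemma is_gram_apply_op V Q :
  is_gram Q -> is_gram (fun psi => Q (apply_op V psi)).
Proof.
case=> J [M QE]; exists J, (fun j t => \sum_z M j z * V z t) => psi.
rewrite QE; apply: eq_bigr => j _; congr sqmod; rewrite /apply_op.
under eq_bigr => z _ do rewrite mulr_sumr.
rewrite exchange_big; apply: eq_bigr => t _.
by rewrite mulr_suml; apply: eq_bigr => z _; rewrite mulrA.
Qed.

Lemma is_gram_proj_in Q : is_gram Q ->
  is_gram (fun psi => \sum_x Q (proj_in x psi)).
Proof.
case=> J [M QE].
exists (bits n * J)%type, (fun a t => if t.1.2.1 == a.1 then M a.2 t else 0).
move=> psi; rewrite /gram.
rewrite -(pair_bigA _ (fun x j =>
  sqmod (\sum_(t : T) (if t.1.2.1 == x then M j t else 0) * psi t))) /=.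
apply: eq_bigr => x _; rewrite QE; apply: eq_bigr => j _; congr sqmod.
by apply: eq_bigr => t _; rewrite /proj_in; case: ifP; rewrite ?mulr0 ?mul0r.
Qed.

Lemma is_gram_run H f s i : is_gram (run H f s i).
Proof.
elim: s i => [|[] s IH] i /=.
- apply: (is_gram_apply_op (U i)
    (Q := fun psi => \sum_(t | acc t) sqmod (psi t))).
  (* The matrix of the diagonal projector onto the accepting outcomes. *)
  exists T, (fun t t' => (acc t && (t == t'))%:R) => psi.
  rewrite big_mkcond; apply: eq_bigr => t _; case: ifP => _; last first.
    by rewrite big1 ?sqmod0 // => t' _; rewrite mul0r.
  rewrite (bigD1 t) //= eqxx mul1r big1 ?addr0 // => t' tt'.
  by rewrite eq_sym (negbTE tt') mul0r.
- apply: (is_gram_apply_op (U i) (Q := fun psi => run H f s i.+1 (OH H psi))).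
  have := is_gram_perm (permHK H) (IH i.+1); congr is_gram.
  by apply: funext => psi; rewrite OHE.
- apply: (is_gram_apply_op (U i)
    (Q := fun psi => \sum_x run H f s i.+1 (OEv f (proj_in x psi)))).
  apply: (is_gram_proj_in (Q := fun psi => run H f s i.+1 (OEv f psi))).
  have := is_gram_perm (permEvK f) (IH i.+1); congr is_gram.
  by apply: funext => psi; rewrite OEvE.
Qed.

Lemma is_gram_ge0 Q psi : is_gram Q -> 0 <= Q psi.
Proof. by case=> J [M ->]; apply: gram_ge0. Qed.

Lemma is_gram_quadratic Q : is_gram Q -> quadratic Q.
Proof.
by case=> J [M QE] r s u v; rewrite /polar !QE quadratic_gram.
Qed.

Lemma is_gram_cavg (Y : finType) Q (psi : Y -> state R T) :
  is_gram Q -> (0 < #|Y|)%N ->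
  Q (fun t => cavg (fun y => psi y t)) <= avg (fun y => Q (psi y)).
Proof.
case=> J [M QE] Y0; rewrite QE (eq_avg (fun y => QE (psi y))).
exact: gram_cavg.
Qed.

End Run.

(** * Hybrids *)

Section ResampleGap.
Variables (R : realType) (T Z Y : finType).
Hypothesis Y0 : (0 < #|Y|)%N.
Implicit Types (H : {ffun Z -> Y}) (psi : {ffun Z -> Y} -> state R T).

Definition smooth_state z psi H : state R T :=
  fun t => smooth z (fun H => psi H t) H.
Definition fluct_state z psi H : state R T :=
  fun t => fluct z (fun H => psi H t) H.

Lemma avg_sqnorm psi :
  avg (fun H => sqnorm (psi H)) = \sum_t weight (fun H => psi H t).
Proof. exact: avg_sum. Qed.

Lemma avg_sqnorm_pythagoras z psi :
  avg (fun H => sqnorm (psi H)) =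
  avg (fun H => sqnorm (smooth_state z psi H)) +
  avg (fun H => sqnorm (fluct_state z psi H)).
Proof.
rewrite !avg_sqnorm -big_split; apply: eq_bigr => t _.
exact: weight_pythagoras.
Qed.

(** Split [psi] into its smooth part S and its fluctuation D. [polar_le] bounds the cross term for
    each [H]; the inner product of S and D vanishes only after averaging over [H], by Pythagoras.
    The remaining term [Q H D] is at most [|D|^2]. *)
Lemma smooth_gap z psi (Q : {ffun Z -> Y} -> state R T -> R) tau :
  (forall H, quadratic (Q H)) -> (forall H u, 0 <= Q H u) ->
  (forall H u, Q H u <= sqnorm u) -> 0 < tau ->
  avg (fun H => Q H (psi H)) - avg (fun H => Q H (smooth_state z psi H)) <=
  tau * avg (fun H => sqnorm (psi H)) +
  avg (fun H => sqnorm (fluct_state z psi H)) / tau.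
Proof.
move=> qQ Q0 Q1 tau0.
pose S := smooth_state z psi; pose D := fluct_state z psi.
have SD H : psi H = sadd (S H) (D H).
  apply: funext => t; rewrite /sadd /S /D /smooth_state /fluct_state /fluct.
  by rewrite addrC subrK.
have step H : Q H (psi H) - Q H (S H) <=
    2^-1 * (tau * sqnorm (S H) + tau^-1 * sqnorm (D H)
            + (sqnorm (psi H) - sqnorm (S H) - sqnorm (D H))) + sqnorm (D H).
  have := polar_le (S H) (D H) (qQ H) (Q0 H) (Q1 H) tau0.
  rewrite /polar -SD; have := Q1 H (D H); lra.
rewrite -avgB; apply: le_trans (ler_avg step) _.
rewrite avgD avgZ avgD !avgB avgD !avgZ.
have := avg_sqnorm_pythagoras z psi; rewrite -/S -/D.
have : 0 <= avg (fun H => sqnorm (S H)).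
  by apply: avg_ge0 => H; apply: sqnorm_ge0.
have : 0 <= avg (fun H => sqnorm (D H)).
  by apply: avg_ge0 => H; apply: sqnorm_ge0.
move: (avg _) (avg _) (avg _) => d s a d0 s0 ->.
have tV : tau * tau^-1 = 1 by rewrite mulfV // gt_eqF.
have V0 : 0 < tau^-1 by rewrite invr_gt0.
(* This absorbs the second-order term [|D|^2] into the claimed bound; it comes from the square of
   tau - 1/2. *)
have c1 : 1 <= tau + 2^-1 * tau^-1.
  have : 0 <= tau^-1 * (tau - 2^-1) ^+ 2 by rewrite mulr_ge0 ?sqr_ge0 // ltW.
  have -> : tau^-1 * (tau - 2^-1) ^+ 2 =
      (tau * tau^-1) * (tau - 1) + 4^-1 * tau^-1.
    by field; rewrite gt_eqF.
  rewrite tV; lra.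
have := ler_wpM2r d0 c1; have : 0 <= tau * s by rewrite mulr_ge0 // ltW.
lra.
Qed.

End ResampleGap.

(** * Moving one query at a time into the ideal prefix *)

Section Hybrid.
Variables (R : realType) (k n m : nat) (A : adversary R k n m).
Local Notation T := (basis k n m (W A)).
Local Notation Fn := {ffun bits n -> bits m}.
Local Notation key := (bits k * bits n)%type.
Hypothesis U_unitary : forall i, unitary (U (a := A) i).
Implicit Types (H M : Fcs k n m) (F : Fn) (K : key) (L : seq (bits n)).
Implicit Types (Phi : Fcs k n m -> Fn -> state R T).

(** A point [z] has the form (K1, x xor K2) exactly when z.1 = K1 and x = z.2 xor K2, so the input
    is recovered from the point instead of searched for. *)
Definition reprog H F K L : Fcs k n m :=
  [ffun z => if (z.1 == K.1) && (bxor z.2 K.2 \in L)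
             then F (bxor z.2 K.2) else H z].

(** [Phi] is the unnormalised state left by the ideal prefix on one branch of measured inputs [L].
    It does not take the key as an argument, which encodes independence from [K]. *)
Definition hybrid s i Phi L : R :=
  avg (fun F => avg (fun H => avg (fun K =>
    run (reprog H F K L) (FFX (reprog H F K L) K.1 K.2) s i (Phi H F)))).

Definition ideal s i Phi : R :=
  avg (fun F => avg (fun H => run H F s i (Phi H F))).

Definition mass Phi : R := avg (fun F => avg (fun H => sqnorm (Phi H F))).

(** On the branch [L] the state has seen [F] only at the inputs of [L]; this is what makes [F x]
    fresh for [x] outside [L]. *)
Definition local_on L Phi :=
  forall H F F', {in L, F =1 F'} -> Phi H F = Phi H F'.
Definition state_deg d Phi := forall F t, deg d (fun H => Phi H F t).

Local Notation N := ((2 ^ (k + n))%:R : R).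

Lemma card_key : #|{: key}| = (2 ^ (k + n))%N.
Proof. by rewrite card_prod !card_bits expnD. Qed.

Lemma card_key_gt0 : (0 < #|{: key}|)%N.
Proof. by rewrite card_key expn_gt0. Qed.

(** For a fixed point (a, b), each [l] in [L] is matched by the single key (a, b xor l). *)
Lemma avg_key_hit (a : bits k) (b : bits n) L :
  avg (fun K : key => ((a == K.1) && (bxor b K.2 \in L))%:R) <= (size L)%:R / N.
Proof.
rewrite /avg card_key mulrC ler_wpM2r ?invr_ge0 ?ler0n //.
rewrite -natr_sum ler_nat.
have -> : (\sum_(K : key) ((a == K.1) && (bxor b K.2 \in L)) =
           #|[pred K : key | (a == K.1) && (bxor b K.2 \in L)]|)%N.
  rewrite -sum1_card [RHS]big_mkcond; apply: eq_bigr => K _.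
  by rewrite inE; case: ifP.
rewrite -(size_map (fun l => (a, bxor b l)) L).
apply: leq_trans (card_size _); apply: subset_leq_card.
apply/subsetP => -[a' b']; rewrite inE /= => /andP[/eqP-> bL].
by apply/mapP; exists (bxor b b') => //; rewrite bxorKl.
Qed.

Definition hit K L (t : T) := (t.1.1.1.1 == K.1) && (bxor t.1.1.1.2 K.2 \in L).

(** The two queries agree off the hit region. On it [sqmod_half] applies, and both basis
    permutations preserve the region, hence the weight of [phi] there. *)
Lemma sqnorm_OH_reprog H F K L (phi : state R T) :
  sqnorm (fun t => 2^-1%:C%C * (OH (reprog H F K L) phi t - OH H phi t)) <=
  \sum_t (hit K L t)%:R * sqmod (phi t).
Proof.
have hitE M t : hit K L (permH M t) = hit K L t by case: t => [[[[? ?] ?] ?] ?].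
have reE M : \sum_t (hit K L t)%:R * sqmod (phi (permH M t)) =
    \sum_t (hit K L t)%:R * sqmod (phi t).
  rewrite [RHS](reindex (permH M)); last exact/onW_bij/inv_bij/permHK.
  by apply: eq_bigr => t _; rewrite hitE.
have -> : \sum_t (hit K L t)%:R * sqmod (phi t) =
    (\sum_t (hit K L t)%:R * sqmod (phi (permH (reprog H F K L) t))
     + \sum_t (hit K L t)%:R * sqmod (phi (permH H t))) / 2.
  by rewrite !reE; lra.
rewrite -big_split mulr_suml.
apply: ler_sum => t _; rewrite !OHE /= -mulrDr -mulrA.
case: (boolP (hit K L t)) => [_|nh]; first by rewrite mul1r sqmod_half.
have -> : permH (reprog H F K L) t = permH H t.
  move: nh; case: t => [[[[a b] y] e] w]; rewrite /hit /= => nh.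
  by rewrite ffunE /= (negbTE nh).
by rewrite subrr mulr0 sqmod0 mul0r.
Qed.

Lemma hybrid_H_step s i Phi L tau : 0 < tau ->
  hybrid (true :: s) i Phi L
  - hybrid s i.+1 (fun H F => OH H (apply_op (U i) (Phi H F))) L <=
  (tau + (size L)%:R / N / tau) * mass Phi.
Proof.
move=> tau0; rewrite -avgB -avgZ; apply: ler_avg => F.
rewrite -avgB -avgZ; apply: ler_avg => H; rewrite -avgB /=.
set phi := apply_op _ _.
have nphi : sqnorm phi = sqnorm (Phi H F) by apply: sqnorm_unitary.
have step K (M := reprog H F K L) :
    run M (FFX M K.1 K.2) s i.+1 (OH M phi)
    - run M (FFX M K.1 K.2) s i.+1 (OH H phi) <=
    tau * sqnorm phi + tau^-1 * \sum_t (hit K L t)%:R * sqmod (phi t).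
  have gr := is_gram_run A M (FFX M K.1 K.2) s i.+1.
  apply: le_trans (quadratic_diff_le (is_gram_quadratic gr)
    (fun u => is_gram_ge0 u gr) (run_le_sqnorm U_unitary _ _ s i.+1) tau0 _) _.
    by rewrite !sqnorm_OH.
  rewrite sqnorm_OH lerD2l mulrC ler_pM2l ?invr_gt0 //.
  exact: sqnorm_OH_reprog.
(* Since [phi] is free of [K], averaging over the key hits each basis vector with probability at
   most |L| / N. *)
apply: le_trans (ler_avg step) _.
rewrite avgD !avgZ avg_cst ?card_key_gt0 // avg_sum -nphi mulrDl lerD2l.
rewrite mulrAC -[leRHS]mulrC ler_pM2l ?invr_gt0 // /sqnorm mulr_sumr.
apply: ler_sum => t _.
rewrite (eq_avg (g := fun K => sqmod (phi t) * (hit K L t)%:R)) => [|K];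
  last exact: mulrC.
by rewrite avgZ mulrC ler_wpM2r ?sqmod_ge0 // avg_key_hit.
Qed.

Lemma reprog_cons_in H F K L x :
  x \in L -> reprog H F K (x :: L) = reprog H F K L.
Proof.
move=> xL; apply/ffunP => z; rewrite !ffunE inE.
by case: eqP => // _; case: eqP => // ->; rewrite xL.
Qed.

(** Turns an extension of [L] into a change of [H] at one point, where resampling applies. *)
Lemma reprog_cons H F K L x : x \notin L ->
  reprog H F K (x :: L) = reprog (upd H (K.1, bxor x K.2) (F x)) F K L.
Proof.
move=> xL; apply/ffunP => -[a b]; rewrite !ffunE inE xpair_eqE /=.
case: (a =P K.1) => //= _; case: (bxor b K.2 =P x) => [<-|bx] /=.
  by rewrite bxorK eqxx; case: ifP.
by case: (b =P _) => // eb; case: bx; rewrite eb bxorK.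
Qed.

Lemma reprog_eq H F F' K L :
  {in L, F =1 F'} -> reprog H F K L = reprog H F' K L.
Proof.
move=> FF'; apply/ffunP => z; rewrite !ffunE.
by case: ifP => // /andP[_ /FF'].
Qed.

Lemma FFX_reprog H F K L x : x \in L -> FFX (reprog H F K L) K.1 K.2 x = F x.
Proof. by move=> xL; rewrite /FFX ffunE /= eqxx bxorK xL. Qed.

Lemma OEv_proj_in (f g : bits n -> bits m) x (psi : state R T) : f x = g x ->
  OEv f (proj_in x psi) = OEv g (proj_in x psi).
Proof.
move=> fg; apply: funext => -[[h [x' y]] w]; rewrite /OEv /proj_in /=.
by case: eqP => // ->; rewrite fg.
Qed.

(** Sending K to (K1, x xor K2) is a bijection onto the domain of [H], so the average over keys is 1
    / N times the sum over all points; [weight_fluct] bounds that sum for each amplitude. *)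
Lemma avg_weight_fluct d Phi F x : state_deg d Phi ->
  avg (fun K : key => avg (fun H =>
    sqnorm (fluct_state (K.1, bxor x K.2) (Phi^~ F) H))) <=
  d%:R / N * avg (fun H => sqnorm (Phi H F)).
Proof.
move=> dPhi; pose h K : key := (K.1, bxor x K.2).
have hK : involutive h by case=> a b; rewrite /h /= bxorKl.
rewrite (avg_bij (fun z => avg (fun H => sqnorm (fluct_state z (Phi^~ F) H)))
           (inv_bij hK)).
rewrite {1}/avg card_key [d%:R / N]mulrC -mulrA ler_wpM2l ?invr_ge0 ?ler0n //.
under eq_bigr => z _ do rewrite avg_sqnorm.
rewrite exchange_big avg_sqnorm mulr_sumr /=; apply: ler_sum => t _.
by have := weight_fluct (card_bits_gt0 m) (dPhi F t).
Qed.

(** The remainder of a run from a measured branch, as a quadratic form in the state with the oracle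
    [M] fixed. *)
Definition ev_run s i K M (psi : state R T) :=
  run M (FFX M K.1 K.2) s i (OEv (FFX M K.1 K.2) psi).

Lemma is_gram_ev_run s i K M : is_gram (ev_run s i K M).
Proof.
have := is_gram_perm (permEvK (FFX M K.1 K.2))
  (is_gram_run A M (FFX M K.1 K.2) s i).
by congr is_gram; apply: funext => psi; rewrite /ev_run OEvE.
Qed.

Lemma ev_run_le s i K M psi : ev_run s i K M psi <= sqnorm psi.
Proof. by rewrite -(sqnorm_OEv (FFX M K.1 K.2) psi); apply: run_le_sqnorm. Qed.

(* F x is still fresh, so answering the query with it and reprogramming H at z
   amounts to resampling H z in the past: the state is replaced by its average
   over the values of H z. *)
Lemma hybrid_Ev_branch s i Phi L d x tau : 0 < tau ->
  local_on L Phi -> state_deg d Phi -> x \notin L ->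
  avg (fun F => avg (fun K => avg (fun H =>
    ev_run s i K (reprog H F K L) (Phi H F))))
  - avg (fun F => avg (fun K => avg (fun H =>
      ev_run s i K (reprog H F K (x :: L)) (Phi H F)))) <=
  (tau + d%:R / N / tau) * mass Phi.
Proof.
move=> tau0 lPhi dPhi xL; have Y0 := card_bits_gt0 m.
pose z K : key := (K.1, bxor x K.2).
have jensen F K :
    avg (fun H => ev_run s i K (reprog H F K L)
      (smooth_state (z K) (Phi^~ F) H)) <=
    avg (fun H => avg (fun y =>
      ev_run s i K (reprog (upd H (z K) y) F K L) (Phi H F))).
  (* Exchanging [H] with its resampled copy moves the resampling from the oracle to the state;
     Jensen's inequality then brings the average inside the form. *)
  rewrite -(avg_swap (z K) (fun H H' =>
    ev_run s i K (reprog H F K L) (Phi H' F))).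
  by apply: ler_avg => H; apply: is_gram_cavg (is_gram_ev_run s i K _) Y0.
have -> : avg (fun F => avg (fun K => avg (fun H =>
      ev_run s i K (reprog H F K (x :: L)) (Phi H F)))) =
    avg (fun F => avg (fun K => avg (fun H => avg (fun y =>
      ev_run s i K (reprog (upd H (z K) y) F K L) (Phi H F))))).
  (* Resample [F x] as [y]. As [x] is outside [L], neither the state nor [reprog] on [L] changes,
     and [y] appears only as the value programmed at [z K]. *)
  rewrite (avg_resample Y0 x); apply: eq_avg => F; rewrite avg_exchange.
  apply: eq_avg => K; rewrite avg_exchange; apply: eq_avg => H.
  apply: eq_avg => y; rewrite reprog_cons // updE eqxx.
  have Fy : {in L, upd F x y =1 F}.
    by move=> l lL; rewrite updE; case: eqP => // lx; rewrite -lx lL in xL.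
  by rewrite (lPhi H _ _ Fy) (reprog_eq _ _ Fy).
apply: le_trans (_ : avg (fun F => avg (fun K =>
    tau * avg (fun H => sqnorm (Phi H F))
    + tau^-1 * avg (fun H => sqnorm (fluct_state (z K) (Phi^~ F) H)))) <= _).
  rewrite -avgB; apply: ler_avg => F; rewrite -avgB; apply: ler_avg => K.
  apply: le_trans (lerB (lexx _) (jensen F K)) _; rewrite [tau^-1 * _]mulrC.
  apply: (smooth_gap Y0 (z K) (Phi^~ F)
    (Q := fun H => ev_run s i K (reprog H F K L))) => // H.
    exact/is_gram_quadratic/is_gram_ev_run.
    by move=> u; apply/is_gram_ge0/is_gram_ev_run.
  by move=> u; apply: ev_run_le.
rewrite -avgZ; apply: ler_avg => F.
rewrite avgD avg_cst ?card_key_gt0 // avgZ mulrDl lerD2l.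
by rewrite mulrAC -[leRHS]mulrC ler_pM2l ?invr_gt0 // avg_weight_fluct.
Qed.

Definition step_H i Phi H F := OH H (apply_op (U i) (Phi H F)).
Definition measured i x Phi H F := proj_in x (apply_op (U i) (Phi H F)).
Definition step_Ev i x Phi H F := OEv F (measured i x Phi H F).

Lemma state_deg_apply_op d i Phi : state_deg d Phi ->
  state_deg d (fun H F => apply_op (U i) (Phi H F)).
Proof. by move=> dPhi F t; apply: deg_lincomb => t'; apply: dPhi. Qed.

Lemma state_deg_step_H d i Phi :
  state_deg d Phi -> state_deg d.+1 (step_H i Phi).
Proof.
move=> /(state_deg_apply_op i) dPhi F [[[[a b] y] e] w].
(* Sum over the possible answers [v]: each term is an indicator of the single value [H (a, b)] times
   an amplitude of degree at most [d]. *)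
have -> : (fun H => step_H i Phi H F (a, b, y, e, w)) =
    (fun H => \sum_(v : bits m) 1 *
      ((H (a, b) == v)%:R * apply_op (U i) (Phi H F) (a, b, bxor y v, e, w))).
  apply: funext => H; rewrite (bigD1 (H (a, b))) //= eqxx !mul1r big1 ?addr0 //.
  by move=> v vH; rewrite eq_sym (negbTE vH) mul0r mulr0.
apply: deg_lincomb => v.
exact: (degM_coord (card_bits_gt0 m) (a, b) (fun u => (u == v)%:R) (dPhi F _)).
Qed.

Lemma state_deg_measured d i x Phi :
  state_deg d Phi -> state_deg d (measured i x Phi).
Proof.
move=> /(state_deg_apply_op i) dPhi F t; rewrite /measured /proj_in.
by case: (t.1.2.1 == x); [apply: dPhi | apply: deg_cst; apply: card_bits_gt0].
Qed.

Lemma state_deg_step_Ev d i x Phi :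
  state_deg d Phi -> state_deg d (step_Ev i x Phi).
Proof.
move=> /(state_deg_measured i x) dPhi F t; rewrite /step_Ev.
under eq_fun do rewrite OEvE; exact: dPhi.
Qed.

Lemma mass_measured i Phi : \sum_x mass (measured i x Phi) = mass Phi.
Proof.
rewrite -avg_sum; apply: eq_avg => F; rewrite -avg_sum; apply: eq_avg => H.
by rewrite sqnorm_proj_in sqnorm_unitary.
Qed.

Lemma mass_ge0 Phi : 0 <= mass Phi.
Proof. by apply: avg_ge0 => F; apply: avg_ge0 => H; apply: sqnorm_ge0. Qed.

Lemma mass_step_H i Phi : mass (step_H i Phi) = mass Phi.
Proof.
by apply: eq_avg => F; apply: eq_avg => H; rewrite sqnorm_OH sqnorm_unitary.
Qed.

Lemma mass_step_Ev i x Phi : mass (step_Ev i x Phi) = mass (measured i x Phi).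
Proof. by apply: eq_avg => F; apply: eq_avg => H; rewrite sqnorm_OEv. Qed.

(** Both hybrids split along the measured input, and the masses of the branches add up to
    [mass Phi]. In the second one the answer [F x] agrees with the oracle reprogrammed on [x :: L],
    so each branch is an [ev_run] too. *)
Lemma hybrid_Ev_step s i Phi L d tau : 0 < tau ->
  local_on L Phi -> state_deg d Phi ->
  hybrid (false :: s) i Phi L
  - \sum_x hybrid s i.+1 (step_Ev i x Phi) (x :: L) <=
  (tau + d%:R / N / tau) * mass Phi.
Proof.
move=> tau0 lPhi dPhi.
pose before x := avg (fun F => avg (fun K => avg (fun H =>
  ev_run s i.+1 K (reprog H F K L) (measured i x Phi H F)))).
pose after x := avg (fun F => avg (fun K => avg (fun H =>
  ev_run s i.+1 K (reprog H F K (x :: L)) (measured i x Phi H F)))).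
have -> : hybrid (false :: s) i Phi L = \sum_x before x.
  rewrite -avg_sum; apply: eq_avg => F.
  rewrite -avg_sum avg_exchange; apply: eq_avg => K.
  by rewrite -avg_sum.
have -> : \sum_x hybrid s i.+1 (step_Ev i x Phi) (x :: L) = \sum_x after x.
  apply: eq_bigr => x _; apply: eq_avg => F; rewrite avg_exchange.
  apply: eq_avg => K; apply: eq_avg => H; rewrite /ev_run; congr run.
  by apply: OEv_proj_in; rewrite FFX_reprog // mem_head.
rewrite -sumrB -(mass_measured i) mulr_sumr; apply: ler_sum => x _.
(* A repeated input is already programmed, so its two terms coincide. *)
have [xL|xL] := boolP (x \in L).
  rewrite /after; under eq_avg => F do under eq_avg => K do
    under eq_avg => H do rewrite (reprog_cons_in _ _ _ xL).
  rewrite subrr mulr_ge0 ?mass_ge0 // addr_ge0 ?(ltW tau0) //.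
  by rewrite !divr_ge0 ?ler0n ?(ltW tau0).
apply: hybrid_Ev_branch => //; last exact: state_deg_measured.
by move=> H F F' FF'; rewrite /measured (lPhi _ _ _ FF').
Qed.

(** Induction on the remaining schedule. The two counting hypotheses keep [size L] at most [q] at
    every query to H and [d] at most [p] at every query to Ev. *)
Lemma hybrid_le_ideal p q t1 t2 s i Phi L d : 0 < t1 -> 0 < t2 ->
  local_on L Phi -> state_deg d Phi ->
  (d + count id s <= p)%N -> (size L + count negb s <= q)%N ->
  hybrid s i Phi L - ideal s i Phi <=
  ((count id s)%:R * (t1 + q%:R / N / t1)
   + (count negb s)%:R * (t2 + p%:R / N / t2)) * mass Phi.
Proof.
move=> t10 t20; elim: s i Phi L d => [|b s IH] i Phi L d lPhi dPhi.
  (* With no query left, the run no longer consults its oracles and both averages agree. *)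
  move=> _ _; rewrite !mul0r addr0 mul0r subr_le0 le_eqVlt; apply/orP; left.
  apply/eqP; apply: eq_avg => F; apply: eq_avg => H.
  by rewrite avg_cst ?card_key_gt0.
case: b => /= dp lq.
- have lPhi' : local_on L (step_H i Phi).
    by move=> H F F' FF'; rewrite /step_H (lPhi _ _ _ FF').
  have dp' : (d.+1 + count id s <= p)%N by rewrite addSnnS.
  have := IH i.+1 (step_H i Phi) L d.+1 lPhi' (state_deg_step_H i dPhi) dp' lq.
  rewrite mass_step_H.
  have : hybrid (true :: s) i Phi L - hybrid s i.+1 (step_H i Phi) L
      <= (t1 + q%:R / N / t1) * mass Phi.
    apply: le_trans (hybrid_H_step _ _ _ _ t10) _.
    rewrite ler_wpM2r ?mass_ge0 // lerD2l !ler_wpM2r ?invr_ge0 ?ler0n //;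
      rewrite ?(ltW t10) //.
    by rewrite ler_nat; apply: leq_trans lq; apply: leq_addr.
  have -> : ideal s i.+1 (step_H i Phi) = ideal (true :: s) i Phi by [].
  rewrite add0n natrD; lra.
- have dp' : (d <= p)%N by apply: leq_trans dp; apply: leq_addr.
  have IHs : \sum_x (hybrid s i.+1 (step_Ev i x Phi) (x :: L)
      - ideal s i.+1 (step_Ev i x Phi))
      <= \sum_x ((count id s)%:R * (t1 + q%:R / N / t1)
      + (count negb s)%:R * (t2 + p%:R / N / t2)) * mass (measured i x Phi).
    apply: ler_sum => x _; rewrite -mass_step_Ev.
    apply: (IH _ _ _ d) => //; last by rewrite addSnnS.
    - move=> H F F' FF'; rewrite /step_Ev /measured.
      rewrite (lPhi H F F') => [|l lL]; last by apply: FF'; rewrite inE lL orbT.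
      by apply: OEv_proj_in; apply: FF'; rewrite mem_head.
    - exact: state_deg_step_Ev.
  move: IHs; rewrite -mulr_sumr mass_measured sumrB.
  have -> : \sum_x ideal s i.+1 (step_Ev i x Phi) = ideal (false :: s) i Phi.
    rewrite -avg_sum; apply: eq_avg => F; rewrite -avg_sum; exact: eq_avg.
  have : hybrid (false :: s) i Phi L
      - \sum_x hybrid s i.+1 (step_Ev i x Phi) (x :: L)
      <= (t2 + p%:R / N / t2) * mass Phi.
    apply: le_trans (hybrid_Ev_step _ _ t20 lPhi dPhi) _.
    rewrite ler_wpM2r ?mass_ge0 // lerD2l !ler_wpM2r ?invr_ge0 ?ler0n //;
      rewrite ?(ltW t20) //.
    by rewrite ler_nat.
  rewrite add0n natrD; lra.
Qed.

End Hybrid.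

(** * From the hybrids to the stated bound *)

Lemma reprog_nil k n m (H : Fcs k n m) F K : reprog H F K [::] = H.
Proof. by apply/ffunP => z; rewrite ffunE andbF. Qed.

(** Before any query, [L] is empty and the state is constant, hence of degree 0; nothing is
    reprogrammed, so the hybrid is the real game. *)
Lemma adv_prf_FFX_le (R : realType) (k n m : nat) (A : adversary R k n m)
  (t1 t2 : R) :
  valid_adversary A -> 0 < t1 -> 0 < t2 ->
  adv_prf_FFX A <=
  (nquantum A)%:R * (t1 + (nclassical A)%:R / (2 ^ (k + n))%:R / t1)
  + (nclassical A)%:R * (t2 + (nquantum A)%:R / (2 ^ (k + n))%:R / t2).
Proof.
case=> psi1 uA t10 t20.
pose Phi (H : Fcs k n m) (F : {ffun bits n -> bits m}) := psi0 (a := A).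
have cF : (0 < #|{: {ffun bits n -> bits m}}|)%N.
  by apply/card_gt0P; exists [ffun=> [ffun=> false]].
have cH : (0 < #|{: Fcs k n m}|)%N.
  by apply/card_gt0P; exists [ffun=> [ffun=> false]].
have Phi1 : mass Phi = 1 by rewrite /mass /Phi psi1 !avg_cst.
have lPhi : local_on [::] Phi by [].
have dPhi : state_deg 0 Phi by move=> F t; apply/deg_cst/card_bits_gt0.
have := hybrid_le_ideal uA 0 t10 t20 lPhi dPhi
  (leqnn (0 + nquantum A)) (leqnn (0 + nclassical A)).
rewrite Phi1 mulr1 !add0n; apply: le_trans; rewrite le_eqVlt; apply/orP; left.
apply/eqP; congr (_ - _); last exact: avg_exchange.
rewrite /hybrid -[RHS](avg_exchange (X := Fcs k n m)); apply: eq_avg => H.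
rewrite (avg_pair (fun K => out_prob A H (FFX H K.1 K.2))).
rewrite -[LHS](avg_cst (X := {ffun bits n -> bits m})) //.
by apply: eq_avg => F; apply: eq_avg => K; rewrite reprog_nil.
Qed.

(** In terms of the square roots a, b, c of p, q, 1 / N, the squares of the two sides differ by the
    square of 2abc(a - b). *)
Lemma le_sqrt_sum (R : realType) (N p q : R) : 0 < N -> 0 <= p -> 0 <= q ->
  2 * (p * Num.sqrt (q / N) + q * Num.sqrt (p / N)) <=
  Num.sqrt (8 * (p + q) * p * q / N).
Proof.
move=> N0 p0 q0; set a := Num.sqrt p; set b := Num.sqrt q.
set c := Num.sqrt N^-1.
have a0 : 0 <= a by apply: sqrtr_ge0.
have b0 : 0 <= b by apply: sqrtr_ge0.
have c0 : 0 <= c by apply: sqrtr_ge0.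
have pE : p = a ^+ 2 by rewrite sqr_sqrtr.
have qE : q = b ^+ 2 by rewrite sqr_sqrtr.
have NE : N^-1 = c ^+ 2 by rewrite sqr_sqrtr // invr_ge0 ltW.
rewrite (sqrtrM _ p0) (sqrtrM _ q0) -/a -/b -/c pE qE NE.
rewrite -ler_sqr ?nnegrE ?sqrtr_ge0 //; last first.
  by rewrite mulr_ge0 // addr_ge0 // !mulr_ge0 // ?sqr_ge0.
have X0 : 0 <= 8 * (a ^+ 2 + b ^+ 2) * a ^+ 2 * b ^+ 2 * c ^+ 2.
  by rewrite !mulr_ge0 ?addr_ge0 ?sqr_ge0.
rewrite (sqr_sqrtr X0) -subr_ge0.
have -> : 8 * (a ^+ 2 + b ^+ 2) * a ^+ 2 * b ^+ 2 * c ^+ 2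
  - (2 * (a ^+ 2 * (b * c) + b ^+ 2 * (a * c))) ^+ 2 =
  (2 * (a * b * c) * (a - b)) ^+ 2 by ring.
exact: sqr_ge0.
Qed.

Theorem theorem3 (R : realType) (k n m p q : nat) (A : adversary R k n m) :
  valid_adversary A -> nquantum A = p -> nclassical A = q ->
  adv_prf_FFX A <=
    Num.sqrt ((8 * (p + q) * p * q)%:R / (2 ^ (k + n))%:R).
Proof.
move=> vA pA qA; set N := (2 ^ (k + n))%:R.
have N0 : 0 < N :> R by rewrite ltr0n expn_gt0.
have bound (t1 t2 : R) : 0 < t1 -> 0 < t2 ->
    adv_prf_FFX A <= p%:R * (t1 + q%:R / N / t1) + q%:R * (t2 + p%:R / N / t2).
  by rewrite -pA -qA; apply: adv_prf_FFX_le.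
(* When [p] or [q] is 0, an optimal parameter degenerates to 0, which is not allowed; the bound is
   then linear in a free [t > 0], and [t] tends to 0. *)
have scale (c x : R) : 0 <= c -> (forall t, 0 < t -> x <= c * t) -> x <= 0.
  move=> c0 h; apply/ler_addgt0Pr => e e0; rewrite add0r.
  have c1 : 0 < c + 1 by rewrite ltr_wpDl.
  apply: le_trans (h (e / (c + 1)) (divr_gt0 e0 c1)) _.
  by rewrite mulrA ler_pdivrMr // mulrC ler_pM2l // lerDl.
have [p0|p0] := posnP p.
  apply: le_trans (sqrtr_ge0 _); apply: (scale q%:R) => // t t0.
  by have := bound 1 t ltr01 t0; rewrite p0 !mul0r add0r addr0.
have [q0|q0] := posnP q.
  apply: le_trans (sqrtr_ge0 _); apply: (scale p%:R) => // t t0.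
  by have := bound t 1 t0 ltr01; rewrite q0 !mul0r !addr0.
have div_sqrt (x : R) : 0 < x -> x / Num.sqrt x = Num.sqrt x.
  move=> x0; rewrite -{1}(sqr_sqrtr (ltW x0)) expr2 mulfK //.
  by rewrite gt_eqF // sqrtr_gt0.
have pN : 0 < p%:R / N by rewrite divr_gt0 // ltr0n.
have qN : 0 < q%:R / N by rewrite divr_gt0 // ltr0n.
(* The minimisers of t + (q / N) / t and t + (p / N) / t, where the two summands are equal. *)
have := bound (Num.sqrt (q%:R / N)) (Num.sqrt (p%:R / N)).
rewrite !sqrtr_gt0 => /(_ qN pN); rewrite !div_sqrt // => h.
rewrite !natrM natrD; apply: le_trans (le_sqrt_sum N0 _ _); rewrite ?ler0n //.
lra.
Qed.
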